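(* The functions $\mathbf{\Phi}_1,\mathbf{\Phi}_2,\mathbf{\Phi}_3$ satisfy the following $q$-recurrence relations, where every denominator parameter that occurs is assumed different from $1,q^{-1},q^{-2},\dots$. (i) With $\mathbf{\Phi}_i(x,y)=\mathbf{\Phi}_i(q^\alpha,q^\beta;q^\gamma;q,x,y)$ for $i=1,2$, $$(1-q^{\alpha})\mathbf{\Phi}_{1}(q^{\alpha+1},q^\beta;q^\gamma;q,x,y)+q^{\alpha}\mathbf{\Phi}_{1}(qx,qy)-\mathbf{\Phi}_{1}(x,y)=0,$$ $$(1-q^{\beta})\mathbf{\Phi}_{1}(q^\alpha,q^{\beta+1};q^\gamma;q,x,y)+q^{\beta}\mathbf{\Phi}_{1}(qx,y)-\mathbf{\Phi}_{1}(x,y)=0,$$ $$(1-q^{\gamma-1})\mathbf{\Phi}_{1}(q^\alpha,q^\beta;q^{\gamma-1};q,x,y)+q^{\gamma-1}\mathbf{\Phi}_{1}(qx,qy)-\mathbf{\Phi}_{1}(x,y)=0,$$ $$(1-q^{\alpha})\mathbf{\Phi}_{2}(q^{\alpha+1},q^\beta;q^\gamma;q,x,y)+q^{\alpha}\mathbf{\Phi}_{2}(qx,y)-\mathbf{\Phi}_{2}(x,y)=0,$$ $$(1-q^{\beta})\mathbf{\Phi}_{2}(q^\alpha,q^{\beta+1};q^\gamma;q,x,y)+q^{\beta}\mathbf{\Phi}_{2}(x,qy)-\mathbf{\Phi}_{2}(x,y)=0,$$ $$(1-q^{\gamma-1})\mathbf{\Phi}_{2}(q^\alpha,q^\beta;q^{\gamma-1};q,x,y)+q^{\gamma-1}\mathbf{\Phi}_{2}(qx,qy)-\mathbf{\Phi}_{2}(x,y)=0.$$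 (ii) With $\mathbf{\Phi}_3(x,y)=\mathbf{\Phi}_3(q^\alpha;q^\beta;q,x,y)$, $$(1-q^{\alpha})\mathbf{\Phi}_{3}(q^{\alpha+1};q^\beta;q,x,y)+q^{\alpha}\mathbf{\Phi}_{3}(qx,y)-\mathbf{\Phi}_{3}(x,y)=0,$$ $$(1-q^{\beta-1})\mathbf{\Phi}_{3}(q^\alpha;q^{\beta-1};q,x,y)+q^{\beta-1}\mathbf{\Phi}_{3}(qx,qy)-\mathbf{\Phi}_{3}(x,y)=0.$$
   Context: Let $q\in\mathbb{C}$ with $0<|q|<1$. The $q$-shifted factorial is $(a;q)_0=1$, $(a;q)_\ell=\prod_{j=0}^{\ell-1}(1-aq^j)$ for $\ell\ge 1$. The basic Humbert hypergeometric functions are defined by the double series $$\mathbf{\Phi}_{1}(q^{\alpha},q^{\beta};q^{\gamma};q,x,y)=\sum_{n,k=0}^{\infty}\frac{(q^{\alpha};q)_{n+k}(q^{\beta};q)_{n}}{(q^{\gamma};q)_{n+k}(q;q)_{n}(q;q)_{k}}x^{n}y^{k},$$ $$\mathbf{\Phi}_{2}(q^{\alpha},q^{\beta};q^{\gamma};q,x,y)=\sum_{n,k=0}^{\infty}\frac{(q^{\alpha};q)_{n}(q^{\beta};q)_{k}}{(q^{\gamma};q)_{n+k}(q;q)_{n}(q;q)_{k}}x^{n}y^{k},$$ $$\mathbf{\Phi}_{3}(q^{\alpha};q^{\beta};q,x,y)=\sum_{n,k=0}^{\infty}\frac{(q^{\alpha};q)_{n}}{(q^{\beta};q)_{n+k}(q;q)_{n}(q;q)_{k}}x^{n}y^{k},$$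 where the denominator parameter ($q^\gamma$ for $\mathbf\Phi_1,\mathbf\Phi_2$; $q^\beta$ for $\mathbf\Phi_3$) is different from $1,q^{-1},q^{-2},\dots$. *)

(* Defs.v *)
From Stdlib Require Import Reals.
From Coquelicot Require Import Coquelicot.

Open Scope C_scope.

Definition Cexp (z : C) : C :=
  (exp (Re z) * cos (Im z), exp (Re z) * sin (Im z))%R.

(* [qpow lq s] is q^s computed with the logarithm [lq] of q, that is, for an
   [lq] with [Cexp lq = q]; the same [lq] serves for all exponents. *)
Definition qpow (lq s : C) : C := Cexp (s * lq).

Fixpoint qpoch (a q : C) (l : nat) : C :=
  match l with
  | O => 1
  | S j => qpoch a q j * (1 - a * q ^ j)
  end.

Definition admissible (q c : C) : Prop := forall m : nat, c <> / (q ^ m).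

(* [CSeries] and [double_series] are total; they are meaningful for
   convergent series only. *)
Definition CSeries (u : nat -> C) : C :=
  (Series (fun n => Re (u n)), Series (fun n => Im (u n))).

Definition double_series (t : nat -> nat -> C) : C :=
  CSeries (fun n => CSeries (fun k => t n k)).

(* By Tonelli, this is absolute summability over all pairs (n, k), so the
   order of summation in [double_series] is immaterial. *)
Definition abs_summable (t : nat -> nat -> C) : Prop :=
  (forall n, ex_series (fun k => Cmod (t n k))) /\
  ex_series (fun n => Series (fun k => Cmod (t n k))).

(* In the terms below a, b, c stand for the parameters q^alpha, q^beta,
   q^gamma themselves, not for the exponents. *)
Definition Phi1_term (a b c q x y : C) (n k : nat) : C :=
  qpoch a q (n + k) * qpoch b q n
  / (qpoch c q (n + k) * qpoch q q n * qpoch q q k) * x ^ n * y ^ k.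

Definition Phi2_term (a b c q x y : C) (n k : nat) : C :=
  qpoch a q n * qpoch b q k
  / (qpoch c q (n + k) * qpoch q q n * qpoch q q k) * x ^ n * y ^ k.

Definition Phi3_term (a b q x y : C) (n k : nat) : C :=
  qpoch a q n
  / (qpoch b q (n + k) * qpoch q q n * qpoch q q k) * x ^ n * y ^ k.

Definition Phi1 (a b c q x y : C) : C := double_series (Phi1_term a b c q x y).
Definition Phi2 (a b c q x y : C) : C := double_series (Phi2_term a b c q x y).
Definition Phi3 (a b q x y : C) : C := double_series (Phi3_term a b q x y).

(* For generic parameters the series of Phi1, Phi2, Phi3 converge exactly in
   the open unit bidisc, and there they converge for all admissible parameters;
   the second alternative adds the points outside the bidisc at which they
   converge for special parameters (e.g. terminating series). *)
Definition in_domain (t : C -> C -> nat -> nat -> C) (x y : C) : Prop :=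
  (Cmod x < 1 /\ Cmod y < 1)%R \/ abs_summable (t x y).

(* Main.v *)
(** The coefficients satisfy [(1 - a) (aq; q)_m = (1 - a q^m) (a; q)_m] and,
    in the denominator, [(c/q; q)_m (1 - (c/q) q^m) = (1 - c/q) (c; q)_m].
    Hence multiplying the shifted series termwise by [1 - a] gives
    [(1 - a q^m) t n k] with [t] the original term and [m] one of [n], [k],
    [n + k], and the factor [q^m] is absorbed by scaling the variables.  In the
    bidisc the coefficients are bounded, since the partial products [(a; q)_m]
    are bounded and, for an admissible parameter, bounded away from zero. *)

Require Import Defs.
From Stdlib Require Import Reals Lra Lia.
From Coquelicot Require Import Coquelicot.

Open Scope C_scope.

(** * Absolutely convergent series of complex numbers *)

Lemma ex_series_nonneg_le (u v : nat -> R) :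
  (forall n, 0 <= u n <= v n)%R -> ex_series v -> ex_series u.
Proof.
intros H; apply (@ex_series_le R_AbsRing R_CompleteNormedModule).
intros n; change (Rabs (u n) <= v n)%R.
rewrite Rabs_pos_eq; apply H.
Qed.

Lemma im_le_Cmod (z : C) : (Rabs (Im z) <= Cmod z)%R.
Proof. exact (Rle_trans _ _ _ (Rmax_r _ _) (Rmax_Cmod z)). Qed.

Lemma Cmod_le_Rabs (a b : R) : (Cmod (a, b) <= Rabs a + Rabs b)%R.
Proof.
replace (a, b) with (RtoC a + Ci * RtoC b)
  by (apply injective_projections; simpl; ring).
eapply Rle_trans; [apply Cmod_triangle|].
rewrite Cmod_mult, Cmod_Ci, !Cmod_R; lra.
Qed.

Lemma ex_series_abs_Re (u : nat -> C) :
  ex_series (fun n => Cmod (u n)) -> ex_series (fun n => Rabs (Re (u n))).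
Proof.
apply ex_series_nonneg_le; intros n.
split; [apply Rabs_pos | apply re_le_Cmod].
Qed.

Lemma ex_series_abs_Im (u : nat -> C) :
  ex_series (fun n => Cmod (u n)) -> ex_series (fun n => Rabs (Im (u n))).
Proof.
apply ex_series_nonneg_le; intros n.
split; [apply Rabs_pos | apply im_le_Cmod].
Qed.

Lemma CSeries_ext (u v : nat -> C) :
  (forall n, u n = v n) -> CSeries u = CSeries v.
Proof.
intros H; unfold CSeries.
f_equal; apply Series_ext; intros n; now rewrite H.
Qed.

(** Absolute convergence makes the real series of real and imaginary parts of [u] and [v] converge,
    so complex linearity reduces to linearity of [Series] in each component. *)
Lemma CSeries_lin (c d : C) (u v : nat -> C) :
  ex_series (fun n => Cmod (u n)) -> ex_series (fun n => Cmod (v n)) ->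
  CSeries (fun n => c * u n + d * v n) = c * CSeries u + d * CSeries v.
Proof.
intros Hu Hv.
pose proof (ex_series_Rabs _ (ex_series_abs_Re _ Hu)) as Hu1.
pose proof (ex_series_Rabs _ (ex_series_abs_Im _ Hu)) as Hu2.
pose proof (ex_series_Rabs _ (ex_series_abs_Re _ Hv)) as Hv1.
pose proof (ex_series_Rabs _ (ex_series_abs_Im _ Hv)) as Hv2.
(* Both components of [c * u n + d * v n] are real combinations of the same four sequences, so one
   identity serves for both. *)
assert (L : forall (a1 a2 b1 b2 : R),
  Series (fun n => a1 * Re (u n) + a2 * Im (u n)
                   + (b1 * Re (v n) + b2 * Im (v n)))%R =
  (a1 * Series (fun n => Re (u n)) + a2 * Series (fun n => Im (u n))
   + (b1 * Series (fun n => Re (v n)) + b2 * Series (fun n => Im (v n))))%R).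
{ intros a1 a2 b1 b2.
  pose proof (fun a w => @ex_series_scal_l R_AbsRing a w) as Hs.
  simpl in Hs.
  rewrite !Series_plus, !Series_scal_l; auto.
  - apply (ex_series_plus (fun n => a1 * Re (u n))%R); now apply Hs.
  - apply (ex_series_plus (fun n => b1 * Re (v n))%R); now apply Hs. }
apply injective_projections; simpl.
- replace (_ - _ + _)%R with
    (Re c * Series (fun n => Re (u n)) + - Im c * Series (fun n => Im (u n))
     + (Re d * Series (fun n => Re (v n)) + - Im d * Series (fun n => Im (v n))))%R
    by (unfold Re, Im; ring).
  rewrite <- L; apply Series_ext; intros n; unfold Re, Im; simpl; ring.
- replace (_ + _ + _)%R with
    (Im c * Series (fun n => Re (u n)) + Re c * Series (fun n => Im (u n))
     + (Im d * Series (fun n => Re (v n)) + Re d * Series (fun n => Im (v n))))%R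
    by (unfold Re, Im; ring).
  rewrite <- L; apply Series_ext; intros n; unfold Re, Im; simpl; ring.
Qed.

(** The factor 2 comes from bounding the modulus by [Rabs] of the real part plus [Rabs] of the
    imaginary part; this crude bound is enough for comparison. *)
Lemma Cmod_CSeries_le (u : nat -> C) :
  ex_series (fun n => Cmod (u n)) ->
  (Cmod (CSeries u) <= 2 * Series (fun n => Cmod (u n)))%R.
Proof.
intros Hu.
pose proof (ex_series_abs_Re _ Hu) as H1.
pose proof (ex_series_abs_Im _ Hu) as H2.
unfold CSeries; eapply Rle_trans; [apply Cmod_le_Rabs|].
apply Series_Rabs in H1; apply Series_Rabs in H2.
assert (Series (fun n => Rabs (Re (u n))) <= Series (fun n => Cmod (u n)))%R.
{ apply Series_le; [intros n; split; [apply Rabs_pos | apply re_le_Cmod] | easy]. }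
assert (Series (fun n => Rabs (Im (u n))) <= Series (fun n => Cmod (u n)))%R.
{ apply Series_le; [intros n; split; [apply Rabs_pos | apply im_le_Cmod] | easy]. }
lra.
Qed.

Lemma abs_summable_CSeries (t : nat -> nat -> C) :
  abs_summable t -> ex_series (fun n => Cmod (CSeries (t n))).
Proof.
intros [H1 H2].
apply (ex_series_nonneg_le _
         (fun n => 2 * Series (fun k => Cmod (t n k)))%R).
- intros n; split; [apply Cmod_ge_0 | now apply Cmod_CSeries_le].
- now apply (@ex_series_scal_l R_AbsRing).
Qed.

(** * Double series: linearity, comparison and the common recurrence scheme *)

Lemma double_series_ext (s t : nat -> nat -> C) :
  (forall n k, s n k = t n k) -> double_series s = double_series t.
Proof.
intros H; apply CSeries_ext; intros n; apply CSeries_ext; intros k; apply H.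
Qed.

(** Linearity is applied to each inner sum, then to the outer one, where [abs_summable_CSeries]
    supplies convergence. *)
Lemma double_series_lin (c d : C) (s t : nat -> nat -> C) :
  abs_summable s -> abs_summable t ->
  double_series (fun n k => c * s n k + d * t n k) =
  c * double_series s + d * double_series t.
Proof.
intros Hs Ht; unfold double_series.
rewrite <- CSeries_lin; [|now apply abs_summable_CSeries..].
apply CSeries_ext; intros n.
apply CSeries_lin; [apply Hs | apply Ht].
Qed.

Lemma abs_summable_le (K : R) (s t : nat -> nat -> C) :
  (forall n k, Cmod (s n k) <= K * Cmod (t n k))%R ->
  abs_summable t -> abs_summable s.
Proof.
intros H [H1 H2].
assert (H3 : forall n, ex_series (fun k => K * Cmod (t n k))%R)
  by (intros n; now apply (@ex_series_scal_l R_AbsRing)).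
assert (H4 : forall n k, (0 <= Cmod (s n k) <= K * Cmod (t n k))%R)
  by (intros n k; split; [apply Cmod_ge_0 | apply H]).
assert (H5 : forall n, ex_series (fun k => Cmod (s n k)))
  by (intros n; now apply (ex_series_nonneg_le _ _ (H4 n))).
split; [easy|].
apply (ex_series_nonneg_le _ (fun n => K * Series (fun k => Cmod (t n k)))%R).
- intros n; split.
  (* Zero is written as a series of multiples by 0, so that termwise comparison gives the lower
     bound. *)
  + replace 0%R with (Series (fun k => 0 * Cmod (s n k)))%R
      by (rewrite Series_scal_l; ring).
    apply Series_le; [|easy].
    intros k; pose proof (Cmod_ge_0 (s n k)); lra.
  + rewrite <- Series_scal_l; apply Series_le; auto.
- now apply (@ex_series_scal_l R_AbsRing).
Qed.

(* [s] is the shifted series, [w] the power of [q] coming from the scaled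
   variables; for [d = 0] nothing is known about the convergence of [s]. *)
Lemma double_series_recurrence (d a : C) (s w t u : nat -> nat -> C) :
  abs_summable t ->
  (forall n k, Cmod (w n k) <= 1)%R ->
  (forall n k, d * s n k = (1 - a * w n k) * t n k) ->
  (forall n k, u n k = w n k * t n k) ->
  d * double_series s + a * double_series u - double_series t = 0.
Proof.
intros Ht Hw Hs Hu.
assert (Su : abs_summable u).
{ apply (abs_summable_le 1 _ t); [|easy].
  intros n k; rewrite Hu, Cmod_mult.
  apply Rmult_le_compat_r; [apply Cmod_ge_0 | apply Hw]. }
assert (E : d * double_series s = 1 * double_series t + - a * double_series u).
{ rewrite <- double_series_lin by easy.
  (* If [d = 0], the left side is 0 whatever value [double_series s] has, and the hypothesis on [s]
     forces [(1 - a * w n k) * t n k = 0], so the right side is a series of zeros. Otherwise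
     dividing by [d] exhibits [s] as a combination of the summable [t] and [u]. *)
  destruct (Ceq_dec d 0) as [->|Hd].
  - rewrite (double_series_ext (fun n k => 1 * t n k + - a * u n k)
                               (fun n k => 0 * t n k + 0 * t n k)).
    + rewrite double_series_lin by easy; ring.
    + intros n k; rewrite Hu.
      replace (1 * t n k + _) with ((1 - a * w n k) * t n k) by ring.
      rewrite <- Hs; ring.
  - rewrite (double_series_ext s (fun n k => / d * t n k + - a / d * u n k)).
    + rewrite !double_series_lin by easy; field; easy.
    + intros n k.
      replace (s n k) with (/ d * (d * s n k)) by (field; easy).
      rewrite Hs, Hu; field; easy. }
rewrite E; ring.
Qed.

Lemma abs_summable_geom (x y : C) :
  (Cmod x < 1)%R -> (Cmod y < 1)%R -> abs_summable (fun n k => x ^ n * y ^ k).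
Proof.
intros Hx Hy.
assert (G : forall z : C, (Cmod z < 1)%R -> ex_series (fun n => Cmod z ^ n)%R).
{ intros z Hz; apply ex_series_geom.
  rewrite Rabs_pos_eq; [easy | apply Cmod_ge_0]. }
assert (E : forall n k, Cmod (x ^ n * y ^ k) = (Cmod x ^ n * Cmod y ^ k)%R)
  by (intros n k; now rewrite Cmod_mult, !Cmod_pow).
split.
- intros n; apply (ex_series_ext (fun k => Cmod x ^ n * Cmod y ^ k)%R).
  + intros k; now rewrite E.
  + now apply (@ex_series_scal_l R_AbsRing), G.
- apply (ex_series_ext
    (fun n => Series (fun k => Cmod y ^ k) * Cmod x ^ n)%R).
  + intros n; rewrite Rmult_comm, <- Series_scal_l.
    apply Series_ext; intros k; now rewrite E.
  + now apply (@ex_series_scal_l R_AbsRing), G.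
Qed.

(** * Bounds for q-shifted factorials and their reciprocals *)

Lemma infinite_product_bounded (P : nat -> R) (K r : R) :
  (0 <= r < 1)%R -> (0 <= K)%R -> P 0%nat = 1%R ->
  (forall n, 0 <= P n)%R ->
  (forall n, P (S n) <= P n * (1 + K * r ^ n))%R ->
  forall n, (P n <= exp (K / (1 - r)))%R.
Proof.
intros Hr HK P0 Hpos HS n.
(* The uniform bound does not pass through the induction; the sharper exponent does. It is the
   partial geometric sum of the [K * r ^ j] with [j < m], and the step uses [1 + t <= exp t]. *)
assert (Hn : forall m, (P m <= exp (K / (1 - r) * (1 - r ^ m)))%R).
{ induction m as [|m IH].
  - rewrite P0; simpl.
    replace (K / (1 - r) * (1 - 1))%R with 0%R by ring; rewrite exp_0; lra.
  - eapply Rle_trans; [apply HS|].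
    replace (K / (1 - r) * (1 - r ^ S m))%R
      with (K / (1 - r) * (1 - r ^ m) + K * r ^ m)%R by (simpl; field; lra).
    rewrite exp_plus; apply Rmult_le_compat; [apply Hpos| |easy|].
    + assert (0 <= K * r ^ m)%R
        by (apply Rmult_le_pos; [easy | apply pow_le; lra]); lra.
    + apply exp_ineq1_le. }
eapply Rle_trans; [apply Hn|].
assert (H : (K / (1 - r) * (1 - r ^ n) <= K / (1 - r))%R).
{ assert (0 <= K / (1 - r))%R by (apply Rdiv_le_0_compat; lra).
  assert (0 <= r ^ n)%R by (apply pow_le; lra).
  assert (0 <= K / (1 - r) * r ^ n)%R by now apply Rmult_le_pos.
  lra. }
destruct H as [H|H]; [left; now apply exp_increasing | right; now rewrite H].
Qed.

(** Each factor has modulus at most [1 + Cmod a * Cmod q ^ n], so the product bound applies with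
    [K = Cmod a]. *)
Lemma qpoch_bounded (q : C) : (Cmod q < 1)%R ->
  forall a, exists M, forall n, (Cmod (qpoch a q n) <= M)%R.
Proof.
intros Hq a; exists (exp (Cmod a / (1 - Cmod q))).
apply infinite_product_bounded.
- split; [apply Cmod_ge_0 | easy].
- apply Cmod_ge_0.
- apply Cmod_1.
- intros n; apply Cmod_ge_0.
- intros n; simpl; rewrite Cmod_mult.
  apply Rmult_le_compat_l; [apply Cmod_ge_0|].
  eapply Rle_trans; [apply Cmod_triangle|].
  rewrite Cmod_1, Cmod_opp, Cmod_mult, Cmod_pow; lra.
Qed.

(** A vanishing factor would give [c = / q ^ j], an excluded value. *)
Lemma admissible_factor_neq0 (q c : C) :
  q <> 0 -> admissible q c -> forall j, 1 - c * q ^ j <> 0.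
Proof.
intros Hq Hc j H; apply (Hc j).
pose proof (Cpow_nz q j Hq) as Hj.
assert (E : c * q ^ j = 1 - (1 - c * q ^ j)) by ring.
rewrite H in E.
replace c with (c * q ^ j / q ^ j) by (field; easy).
rewrite E; field; easy.
Qed.

Lemma qpoch_neq0 (q c : C) :
  q <> 0 -> admissible q c -> forall n, qpoch c q n <> 0.
Proof.
intros Hq Hc n; induction n as [|n IH]; simpl; [exact C1_nz|].
apply Cmult_neq_0; [easy | now apply admissible_factor_neq0].
Qed.

(** An equality [q = / q ^ m] would make a positive power of [Cmod q] equal to 1. This lets the
    factorials [qpoch q q n] be treated like those of any admissible parameter. *)
Lemma admissible_self (q : C) :
  (0 < Cmod q)%R -> (Cmod q < 1)%R -> admissible q q.
Proof.
intros H0 H1 m E.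
assert (Hq : q <> 0) by now apply Cmod_gt_0.
assert (F : (Cmod q * Cmod q ^ m = 1)%R).
{ rewrite <- Cmod_pow, <- Cmod_mult, E at 1.
  rewrite Cinv_l by (now apply Cpow_nz); apply Cmod_1. }
assert (Cmod q ^ m <= 1)%R by (rewrite <- (pow1 m); apply pow_incr; lra).
assert (Cmod q * Cmod q ^ m <= Cmod q * 1)%R
  by (apply Rmult_le_compat_l; lra).
lra.
Qed.

Lemma finite_lower_bound (f : nat -> R) (N : nat) :
  (forall j, 0 < f j)%R ->
  exists d, (0 < d)%R /\ forall j, (j < N)%nat -> (d <= f j)%R.
Proof.
intros Hf; induction N as [|N [d [Hd H]]].
- exists 1%R; split; [lra | lia].
- exists (Rmin d (f N)); split; [now apply Rmin_glb_lt|].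
  intros j Hj; destruct (Nat.eq_dec j N) as [->|].
  + apply Rmin_r.
  + eapply Rle_trans; [apply Rmin_l | apply H; lia].
Qed.

(** The factors tend to 1: from some index on their modulus is at least 1/2, and the finitely many
    earlier ones are nonzero. *)
Lemma admissible_factor_lower_bound (q c : C) :
  q <> 0 -> (Cmod q < 1)%R -> admissible q c ->
  exists d, (0 < d)%R /\ forall j, (d <= Cmod (1 - c * q ^ j))%R.
Proof.
intros Hq Hq1 Hc.
pose proof (Cmod_ge_0 c) as Hc0; pose proof (Cmod_ge_0 q) as Hq0.
(* This threshold yields [Cmod c * Cmod q ^ j <= 1 / 2] for [j >= N]; adding 1 to [Cmod c] keeps the
   denominator positive when [c = 0]. *)
destruct (pow_lt_1_zero (Cmod q)) with (y := (/ (2 * (Cmod c + 1)))%R)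
  as [N HN].
{ now rewrite Rabs_pos_eq. }
{ apply Rinv_0_lt_compat; lra. }
destruct (finite_lower_bound (fun j => Cmod (1 - c * q ^ j)) N) as [d [Hd H]].
{ intros j; apply Cmod_gt_0; now apply admissible_factor_neq0. }
exists (Rmin d (1 / 2)); split; [apply Rmin_glb_lt; lra|].
intros j; destruct (Nat.lt_ge_cases j N) as [Hj|Hj].
- eapply Rle_trans; [apply Rmin_l | now apply H].
- eapply Rle_trans; [apply Rmin_r|].
  specialize (HN j Hj).
  rewrite Rabs_pos_eq in HN by now apply pow_le.
  pose proof (Cmod_triangle (1 - c * q ^ j) (c * q ^ j)) as T.
  replace (1 - c * q ^ j + c * q ^ j) with (RtoC 1) in T by ring.
  rewrite Cmod_1, Cmod_mult, Cmod_pow in T.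
  assert (Cmod c * Cmod q ^ j <= (Cmod c + 1) * / (2 * (Cmod c + 1)))%R
    by (apply Rmult_le_compat; [easy | now apply pow_le | lra | lra]).
  replace ((Cmod c + 1) * / (2 * (Cmod c + 1)))%R with (1 / 2)%R in *
    by (field; lra).
  lra.
Qed.

(** The reciprocal of [1 - z] is [1 + z / (1 - z)]. With [z = c * q ^ n] and the lower bound [d] on
    the factors, its modulus is at most [1 + Cmod c / d * Cmod q ^ n], again a factor for the
    product bound. *)
Lemma inv_qpoch_bounded (q c : C) :
  q <> 0 -> (Cmod q < 1)%R -> admissible q c ->
  exists M, forall n, (Cmod (/ qpoch c q n) <= M)%R.
Proof.
intros Hq Hq1 Hc.
destruct (admissible_factor_lower_bound q c) as [d [Hd Hj]]; try easy.
exists (exp (Cmod c / d / (1 - Cmod q))).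
apply infinite_product_bounded.
- split; [apply Cmod_ge_0 | easy].
- apply Rdiv_le_0_compat; [apply Cmod_ge_0 | easy].
- simpl; rewrite Cmod_inv by exact C1_nz; rewrite Cmod_1; lra.
- intros n; apply Cmod_ge_0.
- intros n; simpl.
  pose proof (admissible_factor_neq0 q c Hq Hc n) as Hn.
  pose proof (qpoch_neq0 q c Hq Hc n) as Hp.
  replace (/ (qpoch c q n * (1 - c * q ^ n)))
    with (/ qpoch c q n * (1 + c * q ^ n / (1 - c * q ^ n)))
    by (field; easy).
  rewrite Cmod_mult; apply Rmult_le_compat_l; [apply Cmod_ge_0|].
  eapply Rle_trans; [apply Cmod_triangle|].
  rewrite Cmod_1, Cmod_div, Cmod_mult, Cmod_pow by easy.
  apply Rplus_le_compat_l.
  replace (Cmod c / d * Cmod q ^ n)%R with (Cmod c * Cmod q ^ n * / d)%R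
    by (field; lra).
  apply Rmult_le_compat_l.
  + apply Rmult_le_pos; [|apply pow_le]; apply Cmod_ge_0.
  + now apply Rinv_le_contravar.
Qed.

(** * Bounded coefficients and summability in the bidisc *)

Definition bounded2 (f : nat -> nat -> C) : Prop :=
  exists M, forall n k, (Cmod (f n k) <= M)%R.

Lemma bounded2_mult (f g : nat -> nat -> C) :
  bounded2 f -> bounded2 g -> bounded2 (fun n k => f n k * g n k).
Proof.
intros [M Hf] [N Hg]; exists (M * N)%R; intros n k.
rewrite Cmod_mult; apply Rmult_le_compat; auto using Cmod_ge_0.
Qed.

(** The factorials in the coefficients carry the index [n], [k] or [n + k]; a bound in one index is
    transported along each of these. *)
Lemma bounded2_reindex (f : nat -> C) (h : nat -> nat -> nat) :
  (exists M, forall n, (Cmod (f n) <= M)%R) -> bounded2 (fun n k => f (h n k)).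
Proof. intros [M H]; exists M; intros n k; apply H. Qed.

Lemma abs_summable_bounded_coef (f : nat -> nat -> C) (t : nat -> nat -> C)
    (x y : C) :
  (Cmod x < 1)%R -> (Cmod y < 1)%R -> bounded2 f ->
  (forall n k, t n k = f n k * (x ^ n * y ^ k)) -> abs_summable t.
Proof.
intros Hx Hy [M Hf] Ht.
apply (abs_summable_le M _ (fun n k => x ^ n * y ^ k)).
- intros n k; rewrite Ht, Cmod_mult.
  apply Rmult_le_compat_r; [apply Cmod_ge_0 | apply Hf].
- now apply abs_summable_geom.
Qed.

(** * Shift identities for q-shifted factorials and powers of q *)

(** Both sides equal [qpoch a q (S n)], with the first or the last factor split off. *)
Lemma qpoch_shift (a q : C) (n : nat) :
  (1 - a) * qpoch (a * q) q n = (1 - a * q ^ n) * qpoch a q n.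
Proof.
induction n as [|n IH]; simpl; [ring|].
rewrite Cmult_assoc, IH; ring.
Qed.

Lemma Cmod_pow_le_1 (q : C) (n : nat) : (Cmod q < 1)%R -> (Cmod (q ^ n) <= 1)%R.
Proof.
intros H; rewrite Cmod_pow, <- (pow1 n).
apply pow_incr; split; [apply Cmod_ge_0 | lra].
Qed.

Lemma Cexp_add (z w : C) : Cexp (z + w) = Cexp z * Cexp w.
Proof.
unfold Cexp, Re, Im; apply injective_projections; simpl;
  rewrite exp_plus, ?cos_plus, ?sin_plus; ring.
Qed.

Lemma qpow_succ (lq s : C) : qpow lq (s + 1) = qpow lq s * Cexp lq.
Proof. unfold qpow; rewrite <- Cexp_add; apply (f_equal Cexp); ring. Qed.

Lemma qpow_pred (lq s : C) : qpow lq s = qpow lq (s - 1) * Cexp lq.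
Proof. rewrite <- qpow_succ; apply (f_equal (qpow lq)); ring. Qed.

(** This is [qpoch_shift] solved for [1 - c], the form in which it can be substituted when the
    shifted factorial stands in a denominator. *)
Lemma qpoch_ratio (c q : C) (n : nat) :
  q <> 0 -> admissible q (c * q) ->
  1 - c = (1 - c * q ^ n) * qpoch c q n / qpoch (c * q) q n.
Proof.
intros Hq Hc; rewrite <- qpoch_shift; field; now apply qpoch_neq0.
Qed.

(** * Absolute summability of the three Humbert series *)

Section HumbertRelations.

Variable q : C.
Hypothesis (q_gt0 : (0 < Cmod q)%R) (q_lt1 : (Cmod q < 1)%R).

Let q_neq0 : q <> 0.
Proof. now apply Cmod_gt_0. Qed.

Let qpoch_q_neq0 (n : nat) : qpoch q q n <> 0.
Proof. now apply qpoch_neq0, admissible_self. Qed.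

(** The three functions share this denominator, so one bound serves them all. *)
Lemma bounded2_humbert_denominator (c : C) : admissible q c ->
  bounded2 (fun n k => / qpoch c q (n + k) * (/ qpoch q q n * / qpoch q q k)).
Proof.
intros Hc.
assert (B : forall d, admissible q d ->
  exists M, forall n, (Cmod (/ qpoch d q n) <= M)%R)
  by (intros d Hd; now apply inv_qpoch_bounded).
pose proof (B q (admissible_self q q_gt0 q_lt1)) as Bq.
apply bounded2_mult; [|apply bounded2_mult].
- now apply (bounded2_reindex (fun m => / qpoch c q m) Nat.add), B.
- now apply (bounded2_reindex (fun m => / qpoch q q m) (fun n k => n)).
- now apply (bounded2_reindex (fun m => / qpoch q q m) (fun n k => k)).
Qed.

Lemma Phi1_abs_summable (a b c x y : C) :
  admissible q c -> in_domain (Phi1_term a b c q) x y ->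
  abs_summable (Phi1_term a b c q x y).
Proof.
intros Hc [[Hx Hy]|H]; [|easy].
pose proof (qpoch_bounded q q_lt1) as B.
(* The coefficient function stays open here: the boundedness proof builds it factor by factor, and
   [field] then checks it against the term. *)
eapply abs_summable_bounded_coef; [exact Hx | exact Hy | |].
- apply bounded2_mult; [apply bounded2_mult|].
  + apply (bounded2_reindex _ Nat.add (B a)).
  + apply (bounded2_reindex _ (fun n k => n) (B b)).
  + apply (bounded2_humbert_denominator c Hc).
- intros n k; unfold Phi1_term; field; auto using qpoch_neq0.
Qed.

Lemma Phi2_abs_summable (a b c x y : C) :
  admissible q c -> in_domain (Phi2_term a b c q) x y ->
  abs_summable (Phi2_term a b c q x y).
Proof.
intros Hc [[Hx Hy]|H]; [|easy].
pose proof (qpoch_bounded q q_lt1) as B.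
eapply abs_summable_bounded_coef; [exact Hx | exact Hy | |].
- apply bounded2_mult; [apply bounded2_mult|].
  + apply (bounded2_reindex _ (fun n k => n) (B a)).
  + apply (bounded2_reindex _ (fun n k => k) (B b)).
  + apply (bounded2_humbert_denominator c Hc).
- intros n k; unfold Phi2_term; field; auto using qpoch_neq0.
Qed.

Lemma Phi3_abs_summable (a b x y : C) :
  admissible q b -> in_domain (Phi3_term a b q) x y ->
  abs_summable (Phi3_term a b q x y).
Proof.
intros Hb [[Hx Hy]|H]; [|easy].
pose proof (qpoch_bounded q q_lt1) as B.
eapply abs_summable_bounded_coef; [exact Hx | exact Hy | |].
- apply bounded2_mult.
  + apply (bounded2_reindex _ (fun n k => n) (B a)).
  + apply (bounded2_humbert_denominator b Hb).
- intros n k; unfold Phi3_term; field; auto using qpoch_neq0.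
Qed.

(** * Recurrences in each parameter *)

(** The choice of [w] fixes which variables are scaled: [a] carries the index [n + k], so both are,
    whereas an index [n] or [k] scales only [x] or only [y]. *)
Lemma Phi1_recurrence_a (a b c x y : C) :
  abs_summable (Phi1_term a b c q x y) ->
  (1 - a) * Phi1 (a * q) b c q x y + a * Phi1 a b c q (q * x) (q * y)
    - Phi1 a b c q x y = 0.
Proof.
intros H; apply double_series_recurrence with (w := fun n k => q ^ (n + k)).
- easy.
- intros n k; now apply Cmod_pow_le_1.
- intros n k; unfold Phi1_term, Cdiv; rewrite !Cmult_assoc, qpoch_shift; ring.
- intros n k; unfold Phi1_term, Cdiv.
  rewrite !Cpow_mult_l, Cpow_add_r; ring.
Qed.

Lemma Phi1_recurrence_b (a b c x y : C) :
  abs_summable (Phi1_term a b c q x y) ->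
  (1 - b) * Phi1 a (b * q) c q x y + b * Phi1 a b c q (q * x) y
    - Phi1 a b c q x y = 0.
Proof.
intros H; apply double_series_recurrence with (w := fun n k => q ^ n).
- easy.
- intros n k; now apply Cmod_pow_le_1.
- intros n k; unfold Phi1_term, Cdiv.
  (* The factorial of [b * q] is brought next to [1 - b], where [qpoch_shift] applies. *)
  rewrite (Cmult_comm (qpoch a q _)), !Cmult_assoc, qpoch_shift; ring.
- intros n k; unfold Phi1_term, Cdiv; rewrite Cpow_mult_l; ring.
Qed.

(** Here [c] plays the role of the lowered parameter, and the unshifted function has [c * q]. *)
Lemma Phi1_recurrence_c (a b c x y : C) :
  admissible q c -> admissible q (c * q) ->
  abs_summable (Phi1_term a b (c * q) q x y) ->
  (1 - c) * Phi1 a b c q x y + c * Phi1 a b (c * q) q (q * x) (q * y)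
    - Phi1 a b (c * q) q x y = 0.
Proof.
intros Hc Hcq H.
apply double_series_recurrence with (w := fun n k => q ^ (n + k)).
- easy.
- intros n k; now apply Cmod_pow_le_1.
(* The substituted quotient cancels [qpoch c q (n + k)] in the shifted term and puts
   [qpoch (c * q) q (n + k)] in its place. *)
- intros n k; rewrite (qpoch_ratio c q (n + k)) by easy.
  unfold Phi1_term; field; repeat split; auto using qpoch_neq0.
- intros n k; unfold Phi1_term, Cdiv.
  rewrite !Cpow_mult_l, Cpow_add_r; ring.
Qed.

Lemma Phi2_recurrence_a (a b c x y : C) :
  abs_summable (Phi2_term a b c q x y) ->
  (1 - a) * Phi2 (a * q) b c q x y + a * Phi2 a b c q (q * x) y
    - Phi2 a b c q x y = 0.
Proof.
intros H; apply double_series_recurrence with (w := fun n k => q ^ n).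
- easy.
- intros n k; now apply Cmod_pow_le_1.
- intros n k; unfold Phi2_term, Cdiv; rewrite !Cmult_assoc, qpoch_shift; ring.
- intros n k; unfold Phi2_term, Cdiv; rewrite Cpow_mult_l; ring.
Qed.

Lemma Phi2_recurrence_b (a b c x y : C) :
  abs_summable (Phi2_term a b c q x y) ->
  (1 - b) * Phi2 a (b * q) c q x y + b * Phi2 a b c q x (q * y)
    - Phi2 a b c q x y = 0.
Proof.
intros H; apply double_series_recurrence with (w := fun n k => q ^ k).
- easy.
- intros n k; now apply Cmod_pow_le_1.
- intros n k; unfold Phi2_term, Cdiv.
  rewrite (Cmult_comm (qpoch a q _)), !Cmult_assoc, qpoch_shift; ring.
- intros n k; unfold Phi2_term, Cdiv; rewrite Cpow_mult_l; ring.
Qed.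

Lemma Phi2_recurrence_c (a b c x y : C) :
  admissible q c -> admissible q (c * q) ->
  abs_summable (Phi2_term a b (c * q) q x y) ->
  (1 - c) * Phi2 a b c q x y + c * Phi2 a b (c * q) q (q * x) (q * y)
    - Phi2 a b (c * q) q x y = 0.
Proof.
intros Hc Hcq H.
apply double_series_recurrence with (w := fun n k => q ^ (n + k)).
- easy.
- intros n k; now apply Cmod_pow_le_1.
- intros n k; rewrite (qpoch_ratio c q (n + k)) by easy.
  unfold Phi2_term; field; repeat split; auto using qpoch_neq0.
- intros n k; unfold Phi2_term, Cdiv.
  rewrite !Cpow_mult_l, Cpow_add_r; ring.
Qed.

Lemma Phi3_recurrence_a (a b x y : C) :
  abs_summable (Phi3_term a b q x y) ->
  (1 - a) * Phi3 (a * q) b q x y + a * Phi3 a b q (q * x) y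
    - Phi3 a b q x y = 0.
Proof.
intros H; apply double_series_recurrence with (w := fun n k => q ^ n).
- easy.
- intros n k; now apply Cmod_pow_le_1.
- intros n k; unfold Phi3_term, Cdiv; rewrite !Cmult_assoc, qpoch_shift; ring.
- intros n k; unfold Phi3_term, Cdiv; rewrite Cpow_mult_l; ring.
Qed.

Lemma Phi3_recurrence_b (a b x y : C) :
  admissible q b -> admissible q (b * q) ->
  abs_summable (Phi3_term a (b * q) q x y) ->
  (1 - b) * Phi3 a b q x y + b * Phi3 a (b * q) q (q * x) (q * y)
    - Phi3 a (b * q) q x y = 0.
Proof.
intros Hb Hbq H.
apply double_series_recurrence with (w := fun n k => q ^ (n + k)).
- easy.
- intros n k; now apply Cmod_pow_le_1.
- intros n k; rewrite (qpoch_ratio b q (n + k)) by easy.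
  unfold Phi3_term; field; repeat split; auto using qpoch_neq0.
- intros n k; unfold Phi3_term, Cdiv.
  rewrite !Cpow_mult_l, Cpow_add_r; ring.
Qed.

End HumbertRelations.

Theorem theorem2p8 (q lq : C) (hq0 : (0 < Cmod q)%R) (hq1 : (Cmod q < 1)%R)
    (hlq : Cexp lq = q) (alpha beta gamma x y : C) :
  (* (i), Phi1 *)
  (admissible q (qpow lq gamma) ->
   in_domain (Phi1_term (qpow lq alpha) (qpow lq beta) (qpow lq gamma) q) x y ->
   let F := Phi1 (qpow lq alpha) (qpow lq beta) (qpow lq gamma) q in
   (1 - qpow lq alpha)
     * Phi1 (qpow lq (alpha + 1)) (qpow lq beta) (qpow lq gamma) q x y
     + qpow lq alpha * F (q * x) (q * y) - F x y = 0 /\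
   (1 - qpow lq beta)
     * Phi1 (qpow lq alpha) (qpow lq (beta + 1)) (qpow lq gamma) q x y
     + qpow lq beta * F (q * x) y - F x y = 0 /\
   (admissible q (qpow lq (gamma - 1)) ->
    (1 - qpow lq (gamma - 1))
      * Phi1 (qpow lq alpha) (qpow lq beta) (qpow lq (gamma - 1)) q x y
      + qpow lq (gamma - 1) * F (q * x) (q * y) - F x y = 0)) /\
  (* (i), Phi2 *)
  (admissible q (qpow lq gamma) ->
   in_domain (Phi2_term (qpow lq alpha) (qpow lq beta) (qpow lq gamma) q) x y ->
   let F := Phi2 (qpow lq alpha) (qpow lq beta) (qpow lq gamma) q in
   (1 - qpow lq alpha)
     * Phi2 (qpow lq (alpha + 1)) (qpow lq beta) (qpow lq gamma) q x y
     + qpow lq alpha * F (q * x) y - F x y = 0 /\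
   (1 - qpow lq beta)
     * Phi2 (qpow lq alpha) (qpow lq (beta + 1)) (qpow lq gamma) q x y
     + qpow lq beta * F x (q * y) - F x y = 0 /\
   (admissible q (qpow lq (gamma - 1)) ->
    (1 - qpow lq (gamma - 1))
      * Phi2 (qpow lq alpha) (qpow lq beta) (qpow lq (gamma - 1)) q x y
      + qpow lq (gamma - 1) * F (q * x) (q * y) - F x y = 0)) /\
  (* (ii), Phi3 *)
  (admissible q (qpow lq beta) ->
   in_domain (Phi3_term (qpow lq alpha) (qpow lq beta) q) x y ->
   let F := Phi3 (qpow lq alpha) (qpow lq beta) q in
   (1 - qpow lq alpha) * Phi3 (qpow lq (alpha + 1)) (qpow lq beta) q x y
     + qpow lq alpha * F (q * x) y - F x y = 0 /\
   (admissible q (qpow lq (beta - 1)) ->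
    (1 - qpow lq (beta - 1)) * Phi3 (qpow lq alpha) (qpow lq (beta - 1)) q x y
      + qpow lq (beta - 1) * F (q * x) (q * y) - F x y = 0)).
Proof.
rewrite (qpow_succ lq alpha), (qpow_succ lq beta), hlq.
split; [|split]; intros Hadm Hdom.
- apply Phi1_abs_summable in Hdom; [|easy..].
  split; [|split; [|intros Hpred]]; cbv zeta.
  + now apply Phi1_recurrence_a.
  + now apply Phi1_recurrence_b.
  (* Every power with exponent [gamma] becomes [qpow lq (gamma - 1) * q], matching the form [c * q]
     of the lemma. *)
  + rewrite (qpow_pred lq gamma), hlq in *.
    now apply Phi1_recurrence_c.
- apply Phi2_abs_summable in Hdom; [|easy..].
  split; [|split; [|intros Hpred]]; cbv zeta.
  + now apply Phi2_recurrence_a.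
  + now apply Phi2_recurrence_b.
  + rewrite (qpow_pred lq gamma), hlq in *.
    now apply Phi2_recurrence_c.
- apply Phi3_abs_summable in Hdom; [|easy..].
  split; [|intros Hpred]; cbv zeta.
  + now apply Phi3_recurrence_a.
  + rewrite (qpow_pred lq beta), hlq in *.
    now apply Phi3_recurrence_b.
Qed.
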